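(* Let $n=2$, $D(x_0,x_1,x_2;p)=\sum_{k=0}^2\binom{2}{k}p^k(1-p)^{2-k}|p-x_k|$, let $\Omega$ be the set of Borel probability measures on $[0,1]$ and $E(\sigma_0,\sigma_1,\sigma_2;\mu)=\iiiint D(x_0,x_1,x_2;p)\,d\sigma_0(x_0)d\sigma_1(x_1)d\sigma_2(x_2)d\mu(p)$. Let $$p_1=\tfrac13\Big(1+\sqrt[3]{1+3\sqrt{57}}-\tfrac{8}{\sqrt[3]{1+3\sqrt{57}}}\Big)\approx0.3611,$$ the unique real root of $x^3-x^2+3x-1$, and set $p_0=0$, $p_2=1-p_1$, $p_3=1$, $$m_1=m_2=\frac{0.5}{p_1^2+(1-p_1)^2+1}\approx0.325,\qquad m_0=m_3=0.5-m_1\approx0.175,$$ $\mu=\sum_{i=0}^3m_i\delta_{p_i}$, and $$a_0=\frac{2p_1(1-p_1)^2}{p_1^2+(1-p_1)^2+1}\approx0.1916,\qquad a_1=0.5,\qquad a_2=1-a_0.$$ Then the strategy pair $(\delta_{a_0},\delta_{a_1},\delta_{a_2};\mu)$ is a Nash equilibrium, i.e. for all $\sigma_0,\sigma_1,\sigma_2,\nu\in\Omega$, $$E(\delta_{a_0},\delta_{a_1},\delta_{a_2};\nu)\le E(\delta_{a_0},\delta_{a_1},\delta_{a_2};\mu)\le E(\sigma_0,\sigma_1,\sigma_2;\mu),$$ so that $\min_{\sigma}\max_{\nu}E=\max_\nu\min_\sigma E$ is attained at this pair. Moreover, this pair is unique in the following sense: if $\sigma_0,\sigma_1,\sigma_2,\nu\in\Omega$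 satisfy the Nash equilibrium (saddle point) condition above, then $\int x\,d\sigma_i(x)=a_i$ for $i=0,1,2$ and $\nu=\sum_{i=0}^3m_i\delta_{p_i}$.
   Context: $\delta_x$ denotes the unit point mass at $x$. Player II chooses distributions $\sigma_0,\sigma_1,\sigma_2$ (guesses for the coin bias after observing $0,1,2$ heads in two tosses) and Player I chooses a distribution $\nu$ for the bias $p$; Player II pays the expected absolute error $E$. *)

(* Defs.v *)
From mathcomp Require Import all_boot all_order all_algebra.
From mathcomp Require Import all_classical all_reals all_analysis.
Set Implicit Arguments. Unset Strict Implicit. Unset Printing Implicit Defensive.
Import Order.TTheory GRing.Theory Num.Theory.
Local Open Scope classical_set_scope.
Local Open Scope ring_scope.

Section Defs.
Variable R : realType.

Definition I01 : set R := `[(0:R), 1]%classic.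

(* Omega: Borel probability measures on [0,1], i.e. probability measures on
   the Borel sets of R that are concentrated on [0,1]. *)
Definition Omega (mu : probability R R) : Prop := mu I01 = 1%E.

Definition Dpay (x0 x1 x2 p : R) : R :=
  \sum_(k < 3) ('C(2, k))%:R * p ^+ k * (1 - p) ^+ (2 - k)
      * `| p - [:: x0; x1; x2]`_k |.

Definition Epay (s0 s1 s2 mu : set R -> \bar R) : \bar R :=
  (\int[mu]_(p in I01) \int[s2]_(x2 in I01) \int[s1]_(x1 in I01)
     \int[s0]_(x0 in I01) (Dpay x0 x1 x2 p)%:E)%E.

Definition cbrt57 : R := powR (1 + 3 * Num.sqrt 57) (3^-1).

Definition p1 : R := 3^-1 * (1 + cbrt57 - 8 / cbrt57).

Definition pp (i : 'I_4) : R := [:: 0; p1; 1 - p1; 1]`_i.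

Definition m1 : R := (2^-1) / (p1 ^+ 2 + (1 - p1) ^+ 2 + 1).
Definition m0 : R := 2^-1 - m1.
Definition mm (i : 'I_4) : R := [:: m0; m1; m1; m0]`_i.

Definition mustar (A : set R) : \bar R :=
  (\sum_(i < 4) (mm i)%:E * \d_(pp i) A)%E.

Definition a0 : R := 2 * p1 * (1 - p1) ^+ 2 / (p1 ^+ 2 + (1 - p1) ^+ 2 + 1).
Definition a1 : R := 2^-1.
Definition a2 : R := 1 - a0.
Definition aa (i : 'I_3) : R := [:: a0; a1; a2]`_i.

Definition saddle (s0 s1 s2 nu : set R -> \bar R) : Prop :=
  (forall (t0 t1 t2 nu' : probability R R),
      Omega t0 -> Omega t1 -> Omega t2 -> Omega nu' ->
      (Epay s0 s1 s2 nu' <= Epay s0 s1 s2 nu)%E /\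
      (Epay s0 s1 s2 nu <= Epay t0 t1 t2 nu)%E).

End Defs.

(* Main.v *)
(* Write D for the payoff of the guesses (a0, a1, a2) as a function of the
   bias. It is symmetric about 1/2, and the cubic equation of p1 makes p1 a
   double root of a0 - D, so that D <= a0 with equality exactly at the four
   atoms of mu.

   The atoms and the guesses interlace. Replacing each distance |q - c| in the
   payoff by sg(q - a_k) (q - c), which is at most |q - c|, gives a lower bound
   that is affine in the guesses c; random guesses only enter it through their
   means. The weights of mu are balanced: once k heads are observed, the atoms
   to the left and to the right of a_k are equally heavy. Hence the average of
   the affine bound over mu does not depend on c and equals a0.

   Let (sigma, nu) be any saddle point. Comparison with (a, mu) shows that its
   value is a0, so the affine bound is at most a0 at each atom while its
   average over mu is a0; the resulting equalities determine the means of
   sigma. Moreover a achieves a0 against nu, so nu lives on the four atoms, and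
   the optimality of each a_k, which is not an atom, forces the weights of nu
   to be balanced. The only balanced weights of total mass 1 are those of mu. *)
From HB Require Import structures.
Require Import Defs.
From mathcomp Require Import all_boot all_order all_algebra.
From mathcomp Require Import all_classical all_reals all_analysis.
From mathcomp Require Import unstable measurable_realfun ring lra.
Import Order.TTheory GRing.Theory Num.Theory numFieldNormedType.Exports.
Local Open Scope classical_set_scope.
Local Open Scope ring_scope.

Set Implicit Arguments.
Unset Strict Implicit.
Unset Printing Implicit Defensive.

Section weighted_sums.
Context {R : realFieldType} {I : finType}.
Implicit Types (w u v x : I -> R).

Lemma mul_sgr_le_norm (a b : R) : Num.sg a * b <= `|b|.
Proof.
case: (sgrP a) => _; first by rewrite mul0r.
  by rewrite mul1r ler_norm.
by rewrite mulN1r -normrN ler_norm.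
Qed.

Lemma normrD_sg (a d : R) : `|d| <= `|a| -> `|a + d| = `|a| + Num.sg a * d.
Proof.
have [a0|a0|->] := ltrgtP a 0.
- rewrite (ltr0_norm a0) ler_norml ltr0_sg// => d_bound.
  by rewrite ler0_norm; lra.
- rewrite (gtr0_norm a0) ler_norml gtr0_sg// => d_bound.
  by rewrite ger0_norm; lra.
- by rewrite normr0 normr_le0 => /eqP ->; rewrite mulr0 !addr0 normr0.
Qed.

Lemma eq_of_weighted_sum_le w u v :
  (forall i, 0 < w i) -> (forall i, u i <= v i) ->
  \sum_i w i * v i <= \sum_i w i * u i -> u =1 v.
Proof.
move=> w_gt0 uv vu i; apply/eqP; rewrite eq_sym -subr_eq0.
have term_ge0 j : true -> 0 <= w j * (v j - u j).
  by rewrite mulr_ge0 ?subr_ge0// ltW.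
have sum0 : \sum_j w j * (v j - u j) = 0.
  apply/le_anti; rewrite sumr_ge0// andbT.
  by under eq_bigr do rewrite mulrBr; rewrite sumrB subr_le0.
have /eqP := psumr_eq0P term_ge0 sum0 (erefl : xpredT i).
by rewrite mulf_eq0 gt_eqF.
Qed.

(* On a small interval around [a], the weighted sum of distances is affine with
   the balance as slope. *)
Lemma weighted_median_balanced w x (a e : R) : 0 < e -> (forall i, x i != a) ->
  (forall y, `|y - a| <= e ->
     \sum_i w i * `|x i - a| <= \sum_i w i * `|x i - y|) ->
  \sum_i w i * Num.sg (x i - a) = 0.
Proof.
move=> e_gt0 xNa a_min; set balance := \sum_i _.
pose d := \big[Num.min/e]_i `|x i - a|.
have d_gt0 : 0 < d.
  by apply: lt_bigmin => // i _; rewrite normr_gt0 subr_eq0.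
have shift_ge0 t : `|t| = d -> 0 <= t * balance.
  move=> td; have := a_min (a - t).
  rewrite addrAC subrr add0r normrN td bigmin_le_id => /(_ isT).
  rewrite -subr_ge0 -sumrB; congr (0 <= _); rewrite /balance mulr_sumr.
  apply: eq_bigr => i _; rewrite opprB addrCA [t + _]addrC.
  rewrite (@normrD_sg (x i - a)); first by ring.
  by rewrite td bigmin_le.
apply/le_anti; rewrite -(pmulr_rge0 _ d_gt0) -oppr_ge0 -(pmulr_rge0 _ d_gt0).
by rewrite mulrN -mulNr !shift_ge0// ?normrN gtr0_norm.
Qed.

End weighted_sums.

Section integrals.
Context d (T : measurableType d) (R : realType).

Lemma integral_finite_support (I : finType) (x : I -> T)
    (mu : {measure set T -> \bar R}) (D : set T) (f : T -> R) :
  injective x -> (forall i, measurable [set x i]) ->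
  mu.-negligible (~` range x) -> measurable D ->
  mu.-integrable D (EFin \o f) ->
  (\int[mu]_(t in D) (f t)%:E =
   \sum_(i | x i \in D) (f (x i))%:E * mu [set x i])%E.
Proof.
move=> x_inj mx x_supp mD fint.
pose s := [seq i <- index_enum I | x i \in D].
pose U := \big[setU/set0]_(i <- s) [set x i].
have mU : measurable U by exact: bigsetU_measurable.
have UE : U = D `&` range x.
  apply/seteqP; split=> t; rewrite /U -bigcup_seq.
    move=> [i]; rewrite /= mem_filter => /andP[/set_mem Dx _] ->.
    by split=> //; exists i.
  move=> [Dt [i _ xit]]; exists i => //=.
  by rewrite mem_filter mem_index_enum andbT xit mem_set.
have DU_null : mu (D `\` U) = 0%E.
  apply: measure_negligible; first exact: measurableD.
  by apply: negligibleS x_supp => t [Dt] /[!UE] UNt xt; apply: UNt.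
rewrite (negligible_integral _ mD fint DU_null); last exact: measurableD.
rewrite setDD UE setIA setIid -UE integral_bigsetU_EFin//; last 3 first.
- by rewrite filter_uniq// index_enum_uniq.
- by move=> i j _ _ [t [-> /x_inj]].
- apply: measurable_funS mD _ (measurable_int mu fint).
  by rewrite -/U UE; exact: subIsetl.
rewrite big_filter; apply: eq_bigr => i _.
by rewrite -integral_cst//; apply: eq_integral => t /[!inE] ->.
Qed.

Lemma measure_finite_support (I : finType) (x : I -> T)
    (mu : {finite_measure set T -> \bar R}) (A : set T) :
  injective x -> (forall i, measurable [set x i]) ->
  mu.-negligible (~` range x) -> measurable A ->
  (mu A = \sum_(i | x i \in A) mu [set x i])%E.
Proof.
move=> x_inj mx x_supp mA; rewrite -[LHS]mul1e -integral_cst//.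
rewrite (integral_finite_support x_inj mx x_supp mA).
  by apply: eq_bigr => i _; rewrite mul1e.
exact: finite_measure_integrable_cst.
Qed.

Variables (mu : probability T R) (D : set T).
Hypotheses (mD : measurable D) (muD : mu D = 1%E).

Lemma negligible_setC_full : mu.-negligible (~` D).
Proof.
apply/negligibleP; first exact: measurableC.
by apply: etrans (probability_setC mu mD) _; rewrite muD subee.
Qed.

Lemma integral_cst_full (c : R) : (\int[mu]_(_ in D) c%:E = c%:E)%E.
Proof. by rewrite integral_cst// [X in (_ * X)%E]muD mule1. Qed.

Lemma Rintegral_cst_full (c : R) : \int[mu]_(_ in D) c = c.
Proof. by rewrite /Rintegral integral_cst_full. Qed.

Lemma integral_affine (f : T -> R) (b c : R) : mu.-integrable D (EFin \o f) ->
  (\int[mu]_(t in D) (b * f t + c)%:E = (b * \int[mu]_(t in D) f t + c)%:E)%E.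
Proof.
move=> fint; under eq_integral do rewrite EFinD EFinM.
rewrite integralD//=; first last.
- exact: finite_measure_integrable_cst.
- exact: integrableZl.
rewrite integralZl// integral_cst_full EFinD EFinM.
by rewrite /Rintegral fineK//; exact: integrable_fin_num.
Qed.

Lemma integral_le_ub (f : T -> R) (c : R) : mu.-integrable D (EFin \o f) ->
  (forall t, D t -> f t <= c) -> (\int[mu]_(t in D) (f t)%:E <= c%:E)%E.
Proof.
move=> fint fc; rewrite -[leRHS]integral_cst_full.
apply: le_integral => //; first exact: finite_measure_integrable_cst.
by move=> t /[!inE] Dt; rewrite lee_fin fc.
Qed.

Lemma integral_eq_ub_negligible (f : T -> R) (c : R) :
  mu.-integrable D (EFin \o f) -> (forall t, D t -> f t <= c) ->
  (\int[mu]_(t in D) (f t)%:E = c%:E)%E ->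
  mu.-negligible (~` (D `&` f @^-1` [set c])).
Proof.
move=> fint fc intf; pose gap t := (-1) * f t + c.
have gap_integral0 : (\int[mu]_(t in D) `|(gap t)%:E| = 0)%E.
  rewrite (eq_integral (fun t => (gap t)%:E)); last first.
    move=> t /[!inE] Dt; rewrite gee0_abs// lee_fin /gap.
    by have := fc t Dt; lra.
  by rewrite integral_affine// /Rintegral intf/= mulN1r addNr.
have mgap : measurable_fun D (EFin \o gap).
  apply/measurable_EFinP/measurable_funD => //; apply: measurable_funM => //.
  by apply/measurable_EFinP; exact: measurable_int fint.
have gap_ae := (ae_eq_integral_abs mu mD mgap).1 gap_integral0.
apply: negligibleS (negligibleU gap_ae negligible_setC_full) => t tN.
have [Dt|] := pselect (D t); [left => /= /(_ Dt) [gap0]|by right].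
by apply: tN; split=> //=; move: gap0; rewrite /gap; lra.
Qed.

End integrals.

Lemma compact_continuous_integrable {R : realType}
    (mu : {finite_measure set R -> \bar R}) (D : set R) (f : R -> R) :
  compact D -> continuous f -> mu.-integrable D (EFin \o f).
Proof.
move=> cD cf; have mD := compact_measurable cD.
apply: measurable_bounded_integrable => //.
- by rewrite ltey_eq fin_num_measure.
- by apply: measurable_funTS; exact: continuous_measurable_fun.
- have /compact_bounded[M [_ M_bound]] : compact (f @` D).
    by apply: continuous_compact => //; exact: continuous_subspaceT.
  by exists M; split; rewrite ?num_real// => ? ? ? ?; exact: M_bound.
Qed.

Lemma continuous_dist {R : realType} (q : R) :
  continuous (fun x : R => `|q - x|).
Proof.
move=> x; apply: (@cvg_norm _ R).
by apply: cvgB; [exact: cvg_cst|exact: cvg_id].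
Qed.

Section absolute_deviation.
Context {R : realType}.
Variables (D : set R) (s : probability R R).

Definition mean : R := \int[s]_(x in D) x.

Definition absdev (q : R) : R := \int[s]_(x in D) `|q - x|.

Hypotheses (cD : compact D) (sD : s D = 1%E).

Let mD : measurable D := compact_measurable cD.

Let dist_integrable q : s.-integrable D (EFin \o (fun x => `|q - x|)) :=
  compact_continuous_integrable s cD (@continuous_dist R q).

Lemma integral_mean : (\int[s]_(x in D) x%:E = mean%:E)%E.
Proof.
rewrite /mean /Rintegral fineK//; apply: integrable_fin_num => //.
by apply: (compact_continuous_integrable s cD) => x; exact: cvg_id.
Qed.

Lemma absdev_ge (q : R) : `|q - mean| <= absdev q.
Proof.
have qB_integrable : s.-integrable D (EFin \o (fun x : R => q - x)).
  apply: compact_continuous_integrable => // x.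
  by apply: cvgB; [exact: cvg_cst|exact: cvg_id].
suff -> : q - mean = \int[s]_(x in D) (q - x) by exact: le_normr_Rintegral.
rewrite RintegralB//; last 2 first.
- exact: finite_measure_integrable_cst.
- by apply: compact_continuous_integrable => // x; exact: cvg_id.
by rewrite Rintegral_cst_full.
Qed.

Lemma absdev_lipschitz (q r : R) : `|absdev q - absdev r| <= `|q - r|.
Proof.
have cdist2 : continuous (fun x : R => `|q - x| - `|r - x|).
  by move=> x; apply: cvgB; exact: continuous_dist.
have -> : absdev q - absdev r = \int[s]_(x in D) (`|q - x| - `|r - x|).
  by rewrite RintegralB//; exact: dist_integrable.
apply: le_trans (le_normr_Rintegral mD _) _.
  exact: compact_continuous_integrable.
rewrite -[leRHS](Rintegral_cst_full mD sD).
apply: le_Rintegral => //.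
- apply: (compact_continuous_integrable s cD) => x.
  by apply: (@cvg_norm _ R); exact: cdist2.
- exact: finite_measure_integrable_cst.
- move=> x _; apply: le_trans (ler_dist_dist _ _) _.
  by rewrite opprB addrA subrK.
Qed.

Lemma continuous_absdev : continuous absdev.
Proof.
move=> q; apply/cvgrPdist_le => /= e e_gt0; near=> r.
apply: le_trans (absdev_lipschitz _ _) _.
by near: r; exact: (@cvgr_dist_le _ R _ _ _ id q).
Unshelve. all: by end_near. Qed.

End absolute_deviation.

Lemma absdev_dirac {R : realType} (D : set R) (x q : R) :
  measurable D -> D x -> absdev D \d_x q = `|q - x|.
Proof.
move=> mD Dx; rewrite /absdev /Rintegral integral_dirac//.
  by rewrite diracE mem_set// mul1e.
apply/measurable_EFinP/measurable_funTS.
by apply: continuous_measurable_fun; exact: continuous_dist.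
Qed.

Local Notation ord3 k := (@Ordinal 3 k isT).
Local Notation ord4 i := (@Ordinal 4 i isT).

Lemma big_ord3 (V : nmodType) (f : 'I_3 -> V) :
  \sum_k f k = f (ord3 0) + f (ord3 1) + f (ord3 2).
Proof.
rewrite !big_ord_recr big_ord0 /= add0r.
by congr (_ + _ + _); congr f; exact: val_inj.
Qed.

Lemma big_ord4 (V : nmodType) (f : 'I_4 -> V) :
  \sum_i f i = f (ord4 0) + f (ord4 1) + f (ord4 2) + f (ord4 3).
Proof.
rewrite !big_ord_recr big_ord0 /= add0r.
by congr (_ + _ + _ + _); congr f; exact: val_inj.
Qed.

Lemma binomial_pmf2 {R : realType} (q : R) :
  ((binomial_pmf 2 q 0 = ((1 - q) ^+ 2)%R) *
   (binomial_pmf 2 q 1 = (2 * q * (1 - q))%R) *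
   (binomial_pmf 2 q 2 = (q ^+ 2)%R))%type.
Proof. by rewrite /binomial_pmf /onem bin0 bin1 binn; do !split; ring. Qed.

Definition pure_payoff {R : realType} n (x : 'I_n.+1 -> R) (q : R) : R :=
  \sum_(k < n.+1) binomial_pmf n q k * `|q - x k|.

Section parameters.
Context {R : realType}.
Local Notation p := (p1 R).
Local Notation a := (a0 R).

Lemma p1_root : p ^+ 3 - p ^+ 2 + 3 * p - 1 = 0.
Proof.
set s : R := Num.sqrt 57.
have s2 : s ^+ 2 = 57 by rewrite /s sqr_sqrtr.
have s_ge0 : 0 <= s by rewrite /s sqrtr_ge0.
have c_gt0 : 0 < cbrt57 R by rewrite /cbrt57 powR_gt0// -/s; lra.
have c3 : cbrt57 R ^+ 3 = 1 + 3 * s.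
  by rewrite /cbrt57 -powR_mulrn ?powR_ge0// -powRrM mulVf ?powRr1 //; lra.
rewrite /p1; set c := cbrt57 R in c_gt0 c3 *; set d := 8 / c.
have cd : c * d = 8 by rewrite /d mulrC divfK// gt_eqF.
have d3 : d ^+ 3 = 3 * s - 1.
  apply: (@mulfI _ (c ^+ 3)); first by rewrite gt_eqF// exprn_gt0.
  rewrite -exprMn cd c3.
  have -> : (1 + 3 * s) * (3 * s - 1) = 9 * s ^+ 2 - 1 by ring.
  by rewrite s2; ring.
transitivity
    (27^-1 * (c ^+ 3 - d ^+ 3 - 3 * (c * d) * (c - d) + 24 * (c - d) - 2)).
  by field.
by rewrite c3 d3 cd; field.
Qed.

Lemma p1_root_uniq (x : R) : x ^+ 3 - x ^+ 2 + 3 * x - 1 = 0 -> x = p.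
Proof.
move=> x_root; have p_root := p1_root.
have : (x - p) * (x ^+ 2 + x * p + p ^+ 2 - (x + p) + 3) = 0.
  by rewrite -[RHS](subrr 0) -{1}x_root -{1}p_root; ring.
move/eqP; rewrite mulf_eq0 subr_eq0 => /orP[/eqP//|/eqP quot0].
by have := sqr_ge0 x; have := sqr_ge0 p; have := sqr_ge0 (x + p - 1); lra.
Qed.

Lemma p1_bounds : 1 / 3 < p < 1 / 2.
Proof.
have := p1_root; set q := p => q_root.
by apply/andP; split; rewrite ltNge; apply/negP => ?; nra.
Qed.

Lemma sum_sqr_p1_gt0 : 0 < p ^+ 2 + (1 - p) ^+ 2 + 1.
Proof. by have := sqr_ge0 p; have := sqr_ge0 (1 - p); lra. Qed.

Lemma double_p1_onem_gt0 : 0 < 2 * p * (1 - p).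
Proof. by have := p1_bounds; have := @mulr_gt0 _ p (1 - p); lra. Qed.

Lemma a0_eq : a * (1 + p) = 2 * p ^+ 2.
Proof.
have S_neq0 := lt0r_neq0 sum_sqr_p1_gt0; rewrite /a0 mulrAC.
apply: (canLR (mulfK S_neq0)); apply/eqP; rewrite -subr_eq0.
have -> : 2 * p * (1 - p) ^+ 2 * (1 + p) -
    2 * p ^+ 2 * (p ^+ 2 + (1 - p) ^+ 2 + 1) =
    - (2 * p * (p ^+ 3 - p ^+ 2 + 3 * p - 1)) by ring.
by rewrite p1_root mulr0 oppr0.
Qed.

Lemma a0_bounds : 0 < a < p.
Proof.
have := a0_eq; have := p1_bounds; move: p a => q b q_bounds bE.
by apply/andP; split; nra.
Qed.

Lemma m1_eq : m1 R * (p ^+ 2 + (1 - p) ^+ 2 + 1) = 1 / 2.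
Proof. by rewrite /m1 div1r divfK// lt0r_neq0// sum_sqr_p1_gt0. Qed.

Lemma m0_eq : m0 R = m1 R * (p ^+ 2 + (1 - p) ^+ 2).
Proof. by have := m1_eq; rewrite /m0; lra. Qed.

Lemma mm_gt0 i : 0 < mm R i.
Proof.
have m1_gt0 : 0 < m1 R by rewrite /m1 divr_gt0// sum_sqr_p1_gt0.
have m0_gt0 : 0 < m0 R.
  have /andP[p_gt _] := p1_bounds.
  rewrite m0_eq mulr_gt0// ltr_pwDl ?sqr_ge0// exprn_gt0//; lra.
by case: i => -[|[|[|[|//]]]] ?.
Qed.

Lemma sum_mm : \sum_i mm R i = 1.
Proof. by rewrite big_ord4 /mm /m0 /=; field. Qed.

Lemma I01P (x : R) : I01 x <-> 0 <= x <= 1.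
Proof. by rewrite /I01 /= in_itv. Qed.

Lemma I01_pp i : I01 (pp R i).
Proof.
apply/I01P; have p_bounds := p1_bounds.
by case: i => -[|[|[|[|//]]]] ?; rewrite /pp/=; lra.
Qed.

Lemma aa_bounds k : a <= aa R k <= 1 - a.
Proof.
have p_bounds := p1_bounds; have a_bounds := a0_bounds.
by case: k => -[|[|[|//]]] ?; rewrite /aa /a2 /a1 /=; lra.
Qed.

Lemma I01_aa k : I01 (aa R k).
Proof. by apply/I01P; have := aa_bounds k; have := a0_bounds; lra. Qed.

Lemma pp_inj : injective (pp R).
Proof.
have p_bounds := p1_bounds.
move=> [[|[|[|[|//]]]] ?] [[|[|[|[|//]]]] ?]; rewrite /pp/= => ppE;
  by [exact: val_inj|exfalso; lra].
Qed.

Lemma mem_codom_pp (q : R) :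
  (q \in codom (pp R)) = [|| q == 0, q == p, q == 1 - p | q == 1].
Proof.
have -> : codom (pp R) = [:: 0; p; 1 - p; 1].
  by rewrite /codom /image_mem !enum_ordSl enum_ord0.
by rewrite !in_cons orbF.
Qed.

(* The interlacing p_0 < a_0 < p_1 < a_1 < p_2 < a_2 < p_3. *)
Lemma sgr_pp_aa (i : 'I_4) (k : 'I_3) :
  Num.sg (pp R i - aa R k) = if (i <= k)%N then -1 else 1.
Proof.
have p_bounds := p1_bounds; have a_bounds := a0_bounds.
case: i k => -[|[|[|[|//]]]] ? [[|[|[|//]]] ?]; rewrite /pp /aa /a2 /a1 /=;
  by [rewrite ltr0_sg//; lra|rewrite gtr0_sg//; lra].
Qed.

Lemma pp_neq_aa i k : pp R i != aa R k.
Proof.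
by rewrite -subr_eq0 -sgr_eq0 sgr_pp_aa; case: ifP; rewrite ?oppr_eq0 oner_eq0.
Qed.

End parameters.

Section payoff_at_aa.
Context {R : realType}.
Local Notation p := (p1 R).
Local Notation a := (a0 R).
Local Notation D_aa := (Dpay (a0 R) (a1 R) (a2 R)).

Lemma Dpay_pure (x : 'I_3 -> R) (q : R) :
  Dpay (x (ord3 0)) (x (ord3 1)) (x (ord3 2)) q = pure_payoff x q.
Proof.
apply: eq_bigr => k _; rewrite /binomial_pmf /onem -[in RHS]mulr_natl !mulrA.
by case: k => -[|[|[|//]]] lti; rewrite (bool_irrelevance lti isT).
Qed.

Lemma DpayE (x0 x1 x2 q : R) : Dpay x0 x1 x2 q =
  (1 - q) ^+ 2 * `|q - x0| + 2 * q * (1 - q) * `|q - x1| + q ^+ 2 * `|q - x2|.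
Proof. by rewrite /Dpay big_ord3 /= bin0 bin1 binn; ring. Qed.

Lemma Dpay_aa_sym (q : R) : D_aa (1 - q) = D_aa q.
Proof.
rewrite !DpayE /a2 /a1 (_ : 1 - q - a = - (q - (1 - a))); last by ring.
rewrite (_ : 1 - q - 2^-1 = - (q - 2^-1)); last by field.
rewrite (_ : 1 - q - (1 - a) = - (q - a)); last by ring.
by rewrite !normrN; ring.
Qed.

Lemma Dpay_aa_left (q : R) : q <= a -> D_aa q = a - 2 * a * q.
Proof.
have := a0_bounds (R := R); have := p1_bounds (R := R) => p_bounds a_bounds qa.
rewrite DpayE /a2 /a1 !ler0_norm; [by field|lra..].
Qed.

Lemma Dpay_aa_middle (q : R) : a <= q <= 1 / 2 ->
  D_aa q = a - 2 * (q - p) ^+ 2 * (2 + a - 2 * p - q).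
Proof.
have p_bounds := p1_bounds (R := R); have a_bounds := a0_bounds (R := R).
move=> q_bounds; rewrite DpayE /a2 /a1 ger0_norm ?ler0_norm; [|lra..].
have p1_neq0 : 1 + p != 0 by rewrite lt0r_neq0//; lra.
have -> : a = 2 * p ^+ 2 / (1 + p) by rewrite -a0_eq mulfK.
apply/eqP; rewrite -subr_eq0; apply/eqP.
transitivity (2 * q * (p ^+ 3 - p ^+ 2 + 3 * p - 1) * (-1) / (1 + p)).
  by move: p p1_neq0 => r r_neq0; field.
by rewrite p1_root mulr0 !mul0r.
Qed.

Lemma Dpay_aa_leif_half (q : R) : 0 <= q <= 1 / 2 ->
  D_aa q <= a ?= iff (q \in codom (pp R)).
Proof.
have p_bounds := p1_bounds (R := R); have a_bounds := a0_bounds (R := R).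
move=> q_bounds; apply/leifP; rewrite mem_codom_pp.
have [->|q_neq0] := eqVneq q 0.
  by rewrite Dpay_aa_left; [apply/eqP; ring|lra].
have [->|q_neqp] := eqVneq q p.
  by rewrite Dpay_aa_middle; [apply/eqP; ring|lra].
have [q1 q1p] : q != 1 /\ q != 1 - p by split; apply/eqP => ?; lra.
rewrite (negbTE q1) (negbTE q1p) /=.
have [qa|aq] := leP q a.
  have : 0 < a * q by rewrite mulr_gt0// ?lt0r ?q_neq0; lra.
  by rewrite Dpay_aa_left//; lra.
have : 0 < (q - p) ^+ 2 * (2 + a - 2 * p - q).
  by rewrite mulr_gt0// ?exprn_even_gt0 ?subr_eq0 ?q_neqp//; lra.
by rewrite Dpay_aa_middle; lra.
Qed.

Lemma Dpay_aa_leif (q : R) : I01 q -> D_aa q <= a ?= iff (q \in codom (pp R)).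
Proof.
move/I01P => q01; have [q_le|q_gt] := leP q (1 / 2).
  by apply: Dpay_aa_leif_half; lra.
rewrite -Dpay_aa_sym (_ : (q \in _) = (1 - q \in codom (pp R))).
  by apply: Dpay_aa_leif_half; lra.
have flip r : (1 - q == r) = (q == 1 - r) by apply/eqP/eqP; lra.
rewrite !mem_codom_pp !flip subKr subr0 subrr.
by case: (q == 0) (q == p) (q == 1 - p) (q == 1) => -[] [] [].
Qed.

End payoff_at_aa.

Section balance.
Context {R : realType}.
Local Notation p := (p1 R).
Implicit Types (w : 'I_4 -> R) (c x : 'I_3 -> R).

(* Each guess [a_k] is a weighted median of the atoms for the weights that
   [w] induces after the observation [k]. *)
Definition balanced w := forall k : 'I_3,
  \sum_i w i * (binomial_pmf 2 (pp R i) k * Num.sg (pp R i - aa R k)) = 0.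

(* The payoff against a bias [q], continued affinely in the guesses [c] from the
   values for which [c k] is on the same side of [q] as [a_k]. *)
Definition linear_payoff c (q : R) : R :=
  \sum_(k < 3) binomial_pmf 2 q k * (Num.sg (q - aa R k) * (q - c k)).

Lemma pure_payoff_pp i : pure_payoff (aa R) (pp R i) = a0 R.
Proof.
by apply/eqP; rewrite -(Dpay_pure (aa R)) (Dpay_aa_leif (I01_pp i)) codom_f.
Qed.

Lemma linear_payoff_pp i : linear_payoff (aa R) (pp R i) = a0 R.
Proof.
rewrite -[RHS](pure_payoff_pp i).
by apply: eq_bigr => k _; rewrite -normrEsg.
Qed.

Lemma balanced_sum_linear_payoff w c : balanced w ->
  \sum_i w i * linear_payoff c (pp R i) = (\sum_i w i) * a0 R.
Proof.
move=> w_bal; rewrite mulr_suml.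
under [RHS]eq_bigr => i _ do rewrite -(linear_payoff_pp i).
apply/eqP; rewrite -subr_eq0 -sumrB; apply/eqP.
transitivity (\sum_(k < 3) (aa R k - c k) * \sum_i w i *
    (binomial_pmf 2 (pp R i) k * Num.sg (pp R i - aa R k))); last first.
  by rewrite big1// => k _; rewrite w_bal mulr0.
under [RHS]eq_bigr do rewrite mulr_sumr.
rewrite exchange_big; apply: eq_bigr => i _ /=.
by rewrite -mulrBr -sumrB mulr_sumr; apply: eq_bigr => k _; ring.
Qed.

Lemma balancedE w : balanced w <->
  [/\ w (ord4 0) = (1 - p) ^+ 2 * w (ord4 1) + p ^+ 2 * w (ord4 2),
      w (ord4 1) = w (ord4 2) &
      w (ord4 3) = p ^+ 2 * w (ord4 1) + (1 - p) ^+ 2 * w (ord4 2)].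
Proof.
have pq_neq0 := lt0r_neq0 (double_p1_onem_gt0 (R := R)).
split=> [w_bal|[w0 w12 w3] k].
  have := w_bal (ord3 2); have := w_bal (ord3 1); have := w_bal (ord3 0).
  rewrite !big_ord4 !binomial_pmf2 !sgr_pp_aa /pp/= => bal0 bal1 bal2.
  by split; [lra|apply: (mulfI pq_neq0); lra|lra].
rewrite big_ord4 !sgr_pp_aa /pp/= w0 w3 w12.
by case: k => -[|[|[|//]]] ? /=; rewrite !binomial_pmf2; ring.
Qed.

Lemma balanced_mm : balanced (mm R).
Proof. by apply/balancedE; rewrite /mm/= m0_eq; split; ring. Qed.

Lemma balanced_uniq w : \sum_i w i = 1 -> balanced w -> w =1 mm R.
Proof.
rewrite big_ord4 => w_sum /balancedE[w0 w12 w3].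
have w1E : w (ord4 1) = m1 R.
  apply: (mulIf (lt0r_neq0 sum_sqr_p1_gt0)).
  by rewrite m1_eq; move: w_sum; rewrite w0 w3 -w12; lra.
have w0E : w (ord4 0) = m0 R by rewrite w0 -w12 w1E m0_eq; ring.
have w3E : w (ord4 3) = m0 R by rewrite w3 -w12 w1E m0_eq; ring.
case=> -[|[|[|[|//]]]] lti; rewrite (bool_irrelevance lti isT) /mm//=.
by rewrite -w12.
Qed.

Lemma linear_payoff_inj c :
  (forall i, linear_payoff c (pp R i) = a0 R) -> c =1 aa R.
Proof.
have pq_neq0 := lt0r_neq0 (double_p1_onem_gt0 (R := R)).
move=> c_eq; have excess0 i :
    linear_payoff c (pp R i) - linear_payoff (aa R) (pp R i) = 0.
  by rewrite c_eq linear_payoff_pp subrr.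
have := excess0 (ord4 0); have := excess0 (ord4 1); have := excess0 (ord4 3).
rewrite /linear_payoff !big_ord3 !binomial_pmf2 !sgr_pp_aa /pp/= => at3 at1 at0.
have c0 : c (ord3 0) = aa R (ord3 0) by lra.
have c2 : c (ord3 2) = aa R (ord3 2) by lra.
have c1 : c (ord3 1) = aa R (ord3 1).
  by apply: (mulfI pq_neq0); move: at1; rewrite c0 c2; lra.
by case=> -[|[|[|//]]] lti; rewrite (bool_irrelevance lti isT).
Qed.

Lemma balanced_of_aa_optimal w :
  (forall x, (forall k, I01 (x k)) ->
     (\sum_i w i) * a0 R <= \sum_i w i * pure_payoff x (pp R i)) ->
  balanced w.
Proof.
move=> w_min k; under eq_bigr do rewrite mulrA.
apply: (@weighted_median_balanced _ _ _ (pp R) (aa R k) (a0 R)).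
- by have /andP[] := a0_bounds (R := R).
- by move=> i; exact: pp_neq_aa.
move=> y; rewrite ler_distl => y_near.
pose x := [eta aa R with k |-> y].
have payoff_diff q : pure_payoff x q - pure_payoff (aa R) q =
    binomial_pmf 2 q k * `|q - y| - binomial_pmf 2 q k * `|q - aa R k|.
  rewrite -sumrB (bigD1 k)//= eqxx big1 ?addr0// => j /negbTE jk.
  by rewrite jk subrr.
have I01_x j : I01 (x j).
  rewrite /x /=; case: ifP => _; last exact: I01_aa.
  by apply/I01P; have := aa_bounds (R := R) k; lra.
rewrite -subr_ge0 -sumrB; have := w_min x I01_x.
rewrite mulr_suml -subr_ge0 -sumrB; congr (0 <= _); apply: eq_bigr => i _.
by rewrite -(pure_payoff_pp i) -mulrBr payoff_diff mulrBr !mulrA.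
Qed.

End balance.

Section payoff.
Context {R : realType}.

Lemma compact_I01 : compact (@I01 R).
Proof. exact: segment_compact. Qed.

Lemma measurable_I01 : measurable (@I01 R).
Proof. exact: measurable_itv. Qed.

Lemma Omega_dirac (x : R) : I01 x -> Omega (\d_x : probability R R).
Proof. by move=> x01; rewrite /Omega /= diracE mem_set. Qed.

Section any_number_of_tosses.
Variable n : nat.
Implicit Types s : 'I_n.+1 -> probability R R.

Lemma continuous_binomial_pmf k : continuous (fun q : R => binomial_pmf n q k).
Proof.
move=> q; rewrite /binomial_pmf; apply: cvgMn.
apply: (@cvgM _ _ _ _ (fun x : R => x ^+ k) (fun x => onem x ^+ (n - k))).
  exact: exprn_continuous.
exact: continuous_onemXn.
Qed.

Definition payoff s (q : R) : R :=
  \sum_(k < n.+1) binomial_pmf n q k * absdev (@I01 R) (s k) q.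

Lemma payoff_dirac (x : 'I_n.+1 -> R) (q : R) : (forall k, I01 (x k)) ->
  payoff (fun k => \d_(x k)) q = pure_payoff x q.
Proof.
move=> x01; apply: eq_bigr => k _.
by rewrite absdev_dirac//; exact: measurable_I01.
Qed.

Lemma continuous_payoff s : (forall k, Omega (s k)) -> continuous (payoff s).
Proof.
move=> sO q; apply: cvg_big => [|k _]; first exact: add_continuous.
apply: cvgM; last exact: (continuous_absdev compact_I01 (sO k)).
exact: continuous_binomial_pmf.
Qed.

Lemma payoff_integrable s (nu : probability R R) : (forall k, Omega (s k)) ->
  nu.-integrable (@I01 R) (EFin \o payoff s).
Proof.
move=> sO; apply: compact_continuous_integrable; first exact: compact_I01.
exact: continuous_payoff.
Qed.

End any_number_of_tosses.

Implicit Types (s : 'I_3 -> probability R R) (nu : probability R R).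

Lemma linear_payoff_le s (q : R) : (forall k, Omega (s k)) -> I01 q ->
  linear_payoff (fun k => mean (@I01 R) (s k)) q <= payoff s q.
Proof.
move=> sO /I01P q01; apply: ler_sum => k _; apply: ler_wpM2l.
  exact: binomial_pmf_ge0.
exact: le_trans (mul_sgr_le_norm _ _) (absdev_ge compact_I01 (sO k) q).
Qed.

Definition expected_payoff s (nu : set R -> \bar R) : \bar R :=
  Epay (s (ord3 0)) (s (ord3 1)) (s (ord3 2)) nu.

Lemma expected_payoffE s (nu : set R -> \bar R) : (forall k, Omega (s k)) ->
  expected_payoff s nu = (\int[nu]_(q in @I01 R) (payoff s q)%:E)%E.
Proof.
move=> sO; rewrite /expected_payoff /Epay; congr integral; apply/funext => q.
have integral_dist k b c : (\int[s k]_(x in @I01 R) (b * `|q - x| + c)%:E)%E =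
    (b * absdev (@I01 R) (s k) q + c)%:E.
  apply: (integral_affine measurable_I01 (sO k)).
  by apply: compact_continuous_integrable;
    [exact: compact_I01|exact: continuous_dist].
rewrite /payoff big_ord3 !binomial_pmf2.
under eq_integral => x2 _.
  under eq_integral => x1 _.
    under eq_integral => x0 _ do rewrite DpayE -addrA.
    rewrite integral_dist addrCA.
    over.
  rewrite integral_dist addrA addrC.
  over.
by rewrite integral_dist; congr EFin; ring.
Qed.

Lemma expected_payoff_dirac s (q : R) : (forall k, Omega (s k)) -> I01 q ->
  expected_payoff s \d_q = (payoff s q)%:E.
Proof.
move=> sO q01; rewrite expected_payoffE// integral_dirac.
- by rewrite diracE mem_set// mul1e.
- exact: measurable_I01.
- exact: measurable_int (payoff_integrable \d_q sO).
Qed.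

Lemma expected_payoff_finite_support s nu : (forall k, Omega (s k)) ->
  nu.-negligible (~` range (pp R)) ->
  expected_payoff s nu =
  (\sum_i fine (nu [set pp R i]) * payoff s (pp R i))%:E.
Proof.
move=> sO nu_pp; rewrite expected_payoffE//.
rewrite (integral_finite_support (@pp_inj R) (fun=> measurable_set1 _) nu_pp
  measurable_I01 (payoff_integrable nu sO)).
rewrite -sumEFin; apply: eq_big => [i|i _].
  by rewrite mem_set//; exact: I01_pp.
by rewrite muleC EFinM fineK//; exact: fin_num_measure.
Qed.

End payoff.

Section mustar_probability.
Context {R : realType}.

Let weighted_dirac i : {measure set R -> \bar R} :=
  mscale (NngNum (ltW (mm_gt0 (inord i)))) \d_(pp R (inord i)).

Let mustar_msum : @mustar R = msum weighted_dirac 4.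
Proof.
apply/funext => A; apply: eq_bigr => i _.
by rewrite /weighted_dirac inord_val.
Qed.

Let mustar0 : @mustar R set0 = 0%E.
Proof. by rewrite mustar_msum measure0. Qed.

Let mustar_ge0 A : (0 <= @mustar R A)%E.
Proof. by rewrite mustar_msum measure_ge0. Qed.

Let mustar_semi_sigma_additive : semi_sigma_additive (@mustar R).
Proof. by rewrite mustar_msum; exact: measure_semi_sigma_additive. Qed.

HB.instance Definition _ := isMeasure.Build _ _ _ (@mustar R)
  mustar0 mustar_ge0 mustar_semi_sigma_additive.

Lemma mustar_supset_pp (A : set R) : range (pp R) `<=` A -> @mustar R A = 1%E.
Proof.
move=> ppA; rewrite /mustar -[RHS]/(1%:E) -(sum_mm (R := R)) -sumEFin.
apply: eq_bigr => i _; rewrite diracE mem_set ?mule1//.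
by apply: ppA; exists i.
Qed.

Let mustar_setT : @mustar R setT = 1%E.
Proof. exact: mustar_supset_pp. Qed.

HB.instance Definition _ :=
  Measure_isProbability.Build _ _ _ (@mustar R) mustar_setT.

Lemma Omega_mustar : Omega (@mustar R).
Proof. by apply: mustar_supset_pp => _ [i _ <-]; exact: I01_pp. Qed.

Lemma mustar_set1 i : @mustar R [set pp R i] = (mm R i)%:E.
Proof.
rewrite /mustar (bigD1 i)//= diracE mem_set// mule1 big1 ?adde0// => j ji.
rewrite diracE memNset ?mule0//= => /pp_inj ji'.
by rewrite ji' eqxx in ji.
Qed.

Lemma mustar_negligible_setC_pp : (@mustar R).-negligible (~` range (pp R)).
Proof.
have mpp : measurable (range (pp R)).
  apply: countable_measurable; first by move=> x; exact: measurable_set1.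
  exact/finite_set_countable/finite_image/finite_finset.
exact: negligible_setC_full mpp (mustar_supset_pp (@subset_refl _ _)).
Qed.

End mustar_probability.

Section saddle_points.
Context {R : realType}.
Implicit Types (s t : 'I_3 -> probability R R) (nu : probability R R).
Local Notation a := (a0 R).

Definition dirac_aa (k : 'I_3) : probability R R := \d_(aa R k).

Lemma Omega_dirac_aa k : Omega (dirac_aa k).
Proof. exact/Omega_dirac/I01_aa. Qed.

Lemma payoff_dirac_aa (q : R) :
  payoff dirac_aa q = Dpay (a0 R) (a1 R) (a2 R) q.
Proof. by rewrite (Dpay_pure (aa R)) payoff_dirac//; exact: I01_aa. Qed.

Lemma payoff_dirac_aa_le (q : R) : I01 q -> payoff dirac_aa q <= a.
Proof. by move=> q01; rewrite payoff_dirac_aa (Dpay_aa_leif q01). Qed.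

Lemma expected_payoff_dirac_aa_le nu : Omega nu ->
  (expected_payoff dirac_aa nu <= a%:E)%E.
Proof.
move=> nuO; rewrite (expected_payoffE _ Omega_dirac_aa).
apply: (integral_le_ub measurable_I01 nuO _ payoff_dirac_aa_le).
exact: payoff_integrable Omega_dirac_aa.
Qed.

Lemma expected_payoff_dirac_aa_eq_negligible nu : Omega nu ->
  expected_payoff dirac_aa nu = a%:E -> nu.-negligible (~` range (pp R)).
Proof.
move=> nuO; rewrite (expected_payoffE _ Omega_dirac_aa).
move/(integral_eq_ub_negligible measurable_I01 nuO
  (payoff_integrable nu Omega_dirac_aa) payoff_dirac_aa_le).
apply: negligibleS; apply: subsetC => q [q01 /eqP].
rewrite payoff_dirac_aa (Dpay_aa_leif q01) => /codomP[i ->].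
by exists i.
Qed.

Lemma expected_payoff_mustar s : (forall k, Omega (s k)) ->
  expected_payoff s (@mustar R) = (\sum_i mm R i * payoff s (pp R i))%:E.
Proof.
move=> sO.
rewrite (expected_payoff_finite_support sO mustar_negligible_setC_pp).
by congr EFin; apply: eq_bigr => i _; rewrite [X in fine X]mustar_set1.
Qed.

Lemma sum_mm_linear_payoff (c : 'I_3 -> R) :
  \sum_i mm R i * linear_payoff c (pp R i) = a.
Proof. by rewrite (balanced_sum_linear_payoff _ balanced_mm) sum_mm mul1r. Qed.

Lemma expected_payoff_mustar_ge s : (forall k, Omega (s k)) ->
  (a%:E <= expected_payoff s (@mustar R))%E.
Proof.
move=> sO; rewrite expected_payoff_mustar// lee_fin.
rewrite -(sum_mm_linear_payoff (fun k => mean (@I01 R) (s k))).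
apply: ler_sum => i _; apply: ler_wpM2l; first exact/ltW/mm_gt0.
by apply: linear_payoff_le => //; exact: I01_pp.
Qed.

Lemma expected_payoff_value : expected_payoff dirac_aa (@mustar R) = a%:E.
Proof.
apply/le_anti; rewrite (expected_payoff_dirac_aa_le Omega_mustar).
exact: expected_payoff_mustar_ge Omega_dirac_aa.
Qed.

Variables (s : 'I_3 -> probability R R) (nu : probability R R).
Hypotheses (sO : forall k, Omega (s k)) (nuO : Omega nu).
Hypothesis s_nu_saddle : saddle (s (ord3 0)) (s (ord3 1)) (s (ord3 2)) nu.

Lemma saddle_bias_le (nu' : probability R R) : Omega nu' ->
  (expected_payoff s nu' <= expected_payoff s nu)%E.
Proof.
move=> nuO'.
by have [] := s_nu_saddle (sO (ord3 0)) (sO (ord3 1)) (sO (ord3 2)) nuO'.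
Qed.

Lemma saddle_guess_le t : (forall k, Omega (t k)) ->
  (expected_payoff s nu <= expected_payoff t nu)%E.
Proof.
move=> tO.
by have [] := s_nu_saddle (tO (ord3 0)) (tO (ord3 1)) (tO (ord3 2)) nuO.
Qed.

Lemma saddle_value : expected_payoff s nu = a%:E.
Proof.
apply/le_anti/andP; split.
- apply: le_trans (saddle_guess_le Omega_dirac_aa) _.
  exact: expected_payoff_dirac_aa_le.
- apply: le_trans (expected_payoff_mustar_ge sO) _.
  exact: saddle_bias_le Omega_mustar.
Qed.

Lemma saddle_mean k : mean (@I01 R) (s k) = aa R k.
Proof.
apply: (@linear_payoff_inj _ (fun k => mean (@I01 R) (s k))) => {k}.
apply: (eq_of_weighted_sum_le (@mm_gt0 R)) => [i|].
  apply: le_trans (linear_payoff_le sO (I01_pp i)) _.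
  rewrite -lee_fin -(expected_payoff_dirac sO (I01_pp i)) -saddle_value.
  exact/saddle_bias_le/Omega_dirac/I01_pp.
by rewrite sum_mm_linear_payoff -mulr_suml sum_mm mul1r.
Qed.

Lemma saddle_negligible_setC_pp : nu.-negligible (~` range (pp R)).
Proof.
apply: expected_payoff_dirac_aa_eq_negligible => //; apply/le_anti.
rewrite expected_payoff_dirac_aa_le//= -saddle_value.
exact: saddle_guess_le Omega_dirac_aa.
Qed.

Lemma saddle_weight i : fine (nu [set pp R i]) = mm R i.
Proof.
have w_sum : \sum_j fine (nu [set pp R j]) = 1.
  apply: EFin_inj; rewrite -sumEFin -(probability_setT nu).
  apply/esym/(etrans (measure_finite_support (@pp_inj R)
    (fun=> measurable_set1 _) saddle_negligible_setC_pp measurableT)).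
  apply: eq_big => [j|j _]; first by rewrite in_setT.
  by rewrite fineK//; exact: fin_num_measure.
apply: (balanced_uniq (w := fun j => fine (nu [set pp R j]))) => //.
apply: balanced_of_aa_optimal => x x01.
rewrite w_sum mul1r -lee_fin -saddle_value.
pose t k : probability R R := \d_(x k).
have tO k : Omega (t k) by exact: Omega_dirac.
apply: le_trans (saddle_guess_le tO) _.
rewrite (expected_payoff_finite_support tO saddle_negligible_setC_pp) lee_fin.
by apply: ler_sum => j _; rewrite payoff_dirac.
Qed.

Lemma saddle_mustar A : measurable A -> nu A = mustar A.
Proof.
move=> mA; apply: etrans (measure_finite_support (@pp_inj R)
  (fun=> measurable_set1 _) saddle_negligible_setC_pp mA) _.
rewrite big_mkcond; apply: eq_bigr => i _; rewrite -saddle_weight.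
rewrite fineK; last exact: fin_num_measure.
by rewrite diracE; case: ifP => _; rewrite ?mule1 ?mule0.
Qed.

End saddle_points.

Theorem theorem5p1 (R : realType) :
  (* p1 is the unique real root of x^3 - x^2 + 3x - 1 *)
  (p1 R ^+ 3 - p1 R ^+ 2 + 3 * p1 R - 1 = 0 /\
   forall x : R, x ^+ 3 - x ^+ 2 + 3 * x - 1 = 0 -> x = p1 R) /\
  (* (delta_a0, delta_a1, delta_a2; mu) is a Nash equilibrium *)
  saddle \d_(a0 R) \d_(a1 R) \d_(a2 R) (@mustar R) /\
  (* uniqueness *)
  (forall s0 s1 s2 nu : probability R R,
     Omega s0 -> Omega s1 -> Omega s2 -> Omega nu ->
     saddle s0 s1 s2 nu ->
     ((\int[s0]_(x in @I01 R) x%:E)%E = (a0 R)%:E /\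
      (\int[s1]_(x in @I01 R) x%:E)%E = (a1 R)%:E /\
      (\int[s2]_(x in @I01 R) x%:E)%E = (a2 R)%:E) /\
     (forall A : set R, measurable A -> nu A = mustar A)).
Proof.
pose profile (s0 s1 s2 : probability R R) := nth s0 [:: s0; s1; s2].
have profileO s0 s1 s2 : Omega s0 -> Omega s1 -> Omega s2 ->
    forall k : 'I_3, Omega (profile s0 s1 s2 k).
  by move=> sO0 sO1 sO2 [[|[|[|//]]] ?].
split; first by split; [exact: p1_root|exact: p1_root_uniq].
split=> [t0 t1 t2 nu tO0 tO1 tO2 nuO|s0 s1 s2 nu sO0 sO1 sO2 nuO s_nu_saddle].
- rewrite -[Epay _ _ _ (@mustar R)]/(expected_payoff dirac_aa (@mustar R)).
  rewrite expected_payoff_value; split.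
    exact: expected_payoff_dirac_aa_le.
  exact: (expected_payoff_mustar_ge (profileO _ _ _ tO0 tO1 tO2)).
- have sO := profileO _ _ _ sO0 sO1 sO2.
  split; last exact: (saddle_mustar sO nuO s_nu_saddle).
  rewrite !(integral_mean _ compact_I01).
  have meanE k := congr1 EFin (saddle_mean sO nuO s_nu_saddle k).
  split; first exact: (meanE (ord3 0)).
  by split; [exact: (meanE (ord3 1))|exact: (meanE (ord3 2))].
Qed.
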